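(* Let $V$ be a finite-dimensional vector space over $\mathbb{K}$ and let $\Phi\colon V\otimes V\longrightarrow V\otimes V$ be a linear map. Consider its transpose \[\Phi^*\colon V^*\otimes V^*=(V\otimes V)^*\longrightarrow(V\otimes V)^*=V^*\otimes V^*.\] Then $(V,\Phi)$ is an $\ell$EAS (resp. an $\ell$CEDS, a dual $\ell$CEDS) if and only if $(V^*,\Phi^* )$ is an $\ell$EAS (resp. a dual $\ell$CEDS, an $\ell$CEDS).
   Context: $\mathbb{K}$ is a commutative field and $\tau(x\otimes y)=y\otimes x$. Let $A$ be a vector space and $\Phi\colon A\otimes A\to A\otimes A$ a linear map. $(A,\Phi)$ is an $\ell$EAS (linear extended associative semigroup) if \[(\mathrm{Id}\otimes\Phi)\circ(\Phi\otimes\mathrm{Id})\circ(\mathrm{Id}\otimes\Phi)=(\Phi\otimes\mathrm{Id})\circ(\mathrm{Id}\otimes\tau)\circ(\Phi\otimes\mathrm{Id}).\] $(A,\Phi)$ is an $\ell$CEDS if it is an $\ell$EAS and \[(\mathrm{Id}\otimes\Phi)\circ(\mathrm{Id}\otimes\tau)\circ(\tau\otimes\mathrm{Id})\circ(\Phi\otimes\mathrm{Id})=(\tau\otimes\mathrm{Id})\circ(\Phi\otimes\mathrm{Id})\circ(\mathrm{Id}\otimes\Phi)\circ(\mathrm{Id}\otimes\tau).\] $(A,\Phi)$ is a dual $\ell$CEDS if it is an $\ell$EAS and \[(\Phi\otimes\mathrm{Id})\circ(\tau\otimes\mathrm{Id})\circ(\mathrm{Id}\otimes\tau)\circ(\mathrm{Id}\otimes\Phi)=(\mathrm{Id}\otimes\tau)\circ(\mathrm{Id}\otimes\Phi)\circ(\Phi\otimes\mathrm{Id})\circ(\tau\otimes\mathrm{Id}).\]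 *)

(* Defs.v *)
From HB Require Import structures.
From mathcomp Require Import all_boot all_order all_algebra.
Set Implicit Arguments.
Unset Strict Implicit.
Unset Printing Implicit Defensive.

Import GRing.Theory.
Local Open Scope ring_scope.

Notation dual V := 'Hom(V, _^o).

(* U (x) V is represented by coordinate matrices with respect to e_i (x) f_j,
   where (e_i) and (f_j) are the library's bases of the finite-dimensional
   spaces U and V. The choice of bases is immaterial, by the universal property
   of pure : U -> V -> tensor U V, proved below: tliftP for existence,
   tensor_ext for uniqueness. *)
Definition tensor (K : fieldType) (U V : vectType K) : Type :=
  'M[K]_(\dim {:U}, \dim {:V}).

HB.instance Definition _ (K : fieldType) (U V : vectType K) :=
  Vector.on (tensor U V).

Section Tensor.
Variable K : fieldType.
Implicit Types U V W X Y : vectType K.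

Definition pure U V (u : U) (v : V) : tensor U V :=
  \matrix_(i, j) (coord (vbasis {:U}) i u * coord (vbasis {:V}) j v).

(* The linear map U (x) V -> W induced by f, which is meant to be bilinear. *)
Definition tlift U V W (f : U -> V -> W) : 'Hom(tensor U V, W) :=
  linfun (fun t : tensor U V =>
    \sum_i \sum_j (t : 'M_(_, _)) i j *: f (vbasis {:U})`_i (vbasis {:V})`_j).

Lemma linfunE U V (f : U -> V) : linear f -> linfun f =1 f.
Proof.
move=> fl.
pose g : {linear U -> V} := HB.pack f (GRing.isLinear.Build _ _ _ _ _ fl).
exact: (lfunE g).
Qed.

Fact pure_bilinear U V : bilinear_for *:%R *:%R (@pure U V).
Proof.
split=> w a x y; apply/matrixP=> i j; rewrite !mxE linearP.
  by rewrite mulrDl mulrA.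
by rewrite mulrDr mulrCA.
Qed.

HB.instance Definition _ U V :=
  bilinear_isBilinear.Build K U V (tensor U V) *:%R *:%R (@pure U V)
    (pure_bilinear U V).

Lemma tliftE U V W (f : U -> V -> W) (t : 'M_(\dim {:U}, \dim {:V})) :
  tlift f (t : tensor U V) =
    \sum_i \sum_j t i j *: f (vbasis {:U})`_i (vbasis {:V})`_j.
Proof.
rewrite linfunE // => a x y.
rewrite scaler_sumr -big_split /=; apply: eq_bigr => i _.
rewrite scaler_sumr -big_split /=; apply: eq_bigr => j _.
by rewrite !mxE scalerDl scalerA.
Qed.

Lemma tliftP U V W (f : U -> V -> W) :
  bilinear_for *:%R *:%R f -> forall u v, tlift f (pure u v) = f u v.
Proof.
move=> fB; pose g : {bilinear U -> V -> W} :=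
  HB.pack f (bilinear_isBilinear.Build K U V W *:%R *:%R f fB).
move=> u v; rewrite tliftE -[f u v]/(g u v).
rewrite [in RHS](coord_vbasis (memvf u)) [in RHS](coord_vbasis (memvf v)).
rewrite linear_sumlz.
apply: eq_bigr => i _; rewrite linearZl_LR linear_sumr scaler_sumr.
by apply: eq_bigr => j _; rewrite linearZr_LR scalerA mxE.
Qed.

Lemma tensor_ext U V W (g h : 'Hom(tensor U V, W)) :
  (forall u v, g (pure u v) = h (pure u v)) -> g = h.
Proof.
move=> gh; apply/lfunP => t.
suff -> : t = \sum_i \sum_j (t : 'M_(_, _)) i j *:
    pure (vbasis {:U})`_i (vbasis {:V})`_j.
  rewrite !linear_sum; apply: eq_bigr => i _.
  rewrite !linear_sum; apply: eq_bigr => j _.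
  by rewrite !linearZ /= gh.
rewrite [LHS](matrix_sum_delta t); apply: eq_bigr => i _; apply: eq_bigr => j _.
congr (_ *: _); apply/matrixP=> k l; rewrite !mxE.
rewrite !coord_free ?(basis_free (vbasisP _)) // -natrM mulnb.
by rewrite (eq_sym k) (eq_sym l).
Qed.

Definition tmap U V W X (f : 'Hom(U, W)) (g : 'Hom(V, X)) :
    'Hom(tensor U V, tensor W X) :=
  tlift (fun u v => pure (f u) (g v)).

Definition tswap U V : 'Hom(tensor U V, tensor V U) :=
  tlift (fun u v => pure v u).

Definition tassoc U V W :
    'Hom(tensor (tensor U V) W, tensor U (tensor V W)) :=
  tlift (fun t w => tlift (fun u v => pure u (pure v w)) t).

Definition tassoc_inv U V W :
    'Hom(tensor U (tensor V W), tensor (tensor U V) W) :=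
  tlift (fun u t => tlift (fun v w => pure (pure u v) w) t).

(* The canonical map U^* (x) V^* -> (U (x) V)^*. *)
Definition tdual U V :
    'Hom(tensor (dual U) (dual V), dual (tensor U V)) :=
  tlift (fun (phi : dual U) (psi : dual V) =>
    tlift (fun (u : U) (v : V) => phi u * psi v : K^o)).

Definition transpose U V (f : 'Hom(U, V)) : 'Hom(dual V, dual U) :=
  linfun (fun phi : dual V => (phi \o f)%VF).

Lemma pure_linearl U V a (x y : U) (v : V) :
  pure (a *: x + y) v = a *: pure x v + pure y v.
Proof. exact: (pure_bilinear U V).1. Qed.

Lemma pure_linearr U V a (u : U) (x y : V) :
  pure u (a *: x + y) = a *: pure u x + pure u y.
Proof. exact: (pure_bilinear U V).2. Qed.

Lemma tmapE U V W X (f : 'Hom(U, W)) (g : 'Hom(V, X)) u v :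
  tmap f g (pure u v) = pure (f u) (g v).
Proof.
rewrite /tmap tliftP //; split=> w a x y.
  by rewrite linearP pure_linearl.
by rewrite linearP pure_linearr.
Qed.

Lemma tswapE U V (u : U) (v : V) : tswap U V (pure u v) = pure v u.
Proof.
by rewrite /tswap tliftP //; split=> w a x y;
  rewrite ?pure_linearl ?pure_linearr.
Qed.

Lemma tassocE U V W (u : U) (v : V) (w : W) :
  tassoc U V W (pure (pure u v) w) = pure u (pure v w).
Proof.
have B (w' : W) : bilinear_for *:%R *:%R (fun (u : U) (v : V) => pure u (pure v w')).
  by split=> z a x y; rewrite ?pure_linearl ?pure_linearr.
rewrite /tassoc tliftP; first exact: (tliftP (B w)).
split=> z a x y; first by rewrite linearP.
set f := tlift _; set g := tlift _; set h := tlift _.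
suff -> : f = a *: g + h by rewrite add_lfunE scale_lfunE.
apply: tensor_ext => u' v'; rewrite add_lfunE scale_lfunE !tliftP; try exact: B.
by rewrite pure_linearr pure_linearr.
Qed.

Lemma tassoc_invE U V W (u : U) (v : V) (w : W) :
  tassoc_inv U V W (pure u (pure v w)) = pure (pure u v) w.
Proof.
have B (u' : U) : bilinear_for *:%R *:%R (fun (v : V) (w : W) => pure (pure u' v) w).
  by split=> z a x y; rewrite ?pure_linearr ?pure_linearl // pure_linearl.
rewrite /tassoc_inv tliftP; first exact: (tliftP (B u)).
split=> z a x y; last by rewrite linearP.
set f := tlift _; set g := tlift _; set h := tlift _.
suff -> : f = a *: g + h by rewrite add_lfunE scale_lfunE.
apply: tensor_ext => u' v'; rewrite add_lfunE scale_lfunE !tliftP; try exact: B.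
by rewrite pure_linearl pure_linearl.
Qed.

Lemma tensor3_ext U V W X (g h : 'Hom(tensor (tensor U V) W, X)) :
  (forall u v w, g (pure (pure u v) w) = h (pure (pure u v) w)) -> g = h.
Proof.
move=> gh; apply: tensor_ext => t w.
have L (k : 'Hom(tensor (tensor U V) W, X)) :
    linear (fun t : tensor U V => k (pure t w)).
  by move=> a x y; rewrite pure_linearl linearP.
rewrite -(linfunE (L g)) -(linfunE (L h)); congr (fun_of_lfun _ t).
by apply: tensor_ext => u v; rewrite !linfunE.
Qed.

Lemma tassocK U V W : cancel (tassoc U V W) (tassoc_inv U V W).
Proof.
move=> t; rewrite -comp_lfunE -[RHS](id_lfunE t); congr (fun_of_lfun _ t).
by apply: tensor3_ext => u v w; rewrite comp_lfunE tassocE tassoc_invE id_lfunE.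
Qed.

Lemma tensor3_extr U V W X (g h : 'Hom(tensor U (tensor V W), X)) :
  (forall u v w, g (pure u (pure v w)) = h (pure u (pure v w))) -> g = h.
Proof.
move=> gh; apply: tensor_ext => u t.
have L (k : 'Hom(tensor U (tensor V W), X)) :
    linear (fun t : tensor V W => k (pure u t)).
  by move=> a x y; rewrite pure_linearr linearP.
rewrite -(linfunE (L g)) -(linfunE (L h)); congr (fun_of_lfun _ t).
by apply: tensor_ext => v w; rewrite !linfunE.
Qed.

Lemma tassoc_invK U V W : cancel (tassoc_inv U V W) (tassoc U V W).
Proof.
move=> t; rewrite -comp_lfunE -[RHS](id_lfunE t); congr (fun_of_lfun _ t).
by apply: tensor3_extr => u v w; rewrite comp_lfunE tassoc_invE tassocE id_lfunE.
Qed.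

Lemma transposeE U V (f : 'Hom(U, V)) (phi : dual V) u :
  transpose f phi u = phi (f u).
Proof.
rewrite /transpose linfunE ?comp_lfunE // => a x y.
by apply/lfunP => z; rewrite !(add_lfunE, scale_lfunE, comp_lfunE).
Qed.

Lemma tdualE U V (phi : dual U) (psi : dual V) u v :
  tdual U V (pure phi psi) (pure u v) = phi u * psi v.
Proof.
have B (phi' : dual U) (psi' : dual V) : bilinear_for *:%R *:%R
    (fun (u : U) (v : V) => phi' u * psi' v : K^o).
  split=> w a x y; rewrite linearP; first by rewrite mulrDl -mulrA.
  by rewrite mulrDr mulrCA.
rewrite /tdual tliftP; first exact: (tliftP (B phi psi)).
split=> w a x y; apply: tensor_ext => {}u {}v;
  rewrite !(add_lfunE, scale_lfunE) !tliftP ?(add_lfunE, scale_lfunE);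
  try exact: B.
  by rewrite mulrDl -mulrA.
by rewrite mulrDr mulrCA.
Qed.

Lemma dual_expand U (phi : dual U) :
  phi = \sum_(i < \dim {:U}) phi (vbasis {:U})`_i *:
    (linfun (coord (vbasis {:U}) i : U -> K^o) : dual U).
Proof.
apply/lfunP => u; rewrite sum_lfunE [in LHS](coord_vbasis (memvf u)) linear_sum.
by apply: eq_bigr => i _; rewrite linearZ scale_lfunE lfunE; apply: mulrC.
Qed.

Let tdual_pre U V (xi : dual (tensor U V)) : tensor (dual U) (dual V) :=
  \sum_(i < \dim {:U}) \sum_(j < \dim {:V}) xi (pure (vbasis {:U})`_i (vbasis {:V})`_j) *:
    pure (linfun (coord (vbasis {:U}) i : U -> K^o) : dual U)
         (linfun (coord (vbasis {:V}) j : V -> K^o) : dual V).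

Let tdual_pre_linear U V : linear (@tdual_pre U V).
Proof.
move=> a x y; rewrite /tdual_pre.
rewrite scaler_sumr -big_split /=; apply: eq_bigr => i _.
rewrite scaler_sumr -big_split /=; apply: eq_bigr => j _.
by rewrite add_lfunE scale_lfunE scalerDl scalerA.
Qed.

Let tdual_preK U V : cancel (@tdual_pre U V) (tdual U V).
Proof.
move=> xi; apply: tensor_ext => u v.
rewrite /tdual_pre linear_sum sum_lfunE [in RHS](coord_vbasis (memvf u)).
rewrite [in RHS](coord_vbasis (memvf v)) linear_sumlz linear_sum.
apply: eq_bigr => i _; rewrite linear_sum sum_lfunE linear_sumr linear_sum.
apply: eq_bigr => j _; rewrite linearZ scale_lfunE tdualE !lfunE.
rewrite linearZl_LR linearZr_LR !linearZ.
by congr (_ *: _); apply: mulrC.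
Qed.

Let tdualK_pre U V : cancel (tdual U V) (@tdual_pre U V).
Proof.
move=> t; rewrite -(linfunE (@tdual_pre_linear U V)) -comp_lfunE.
rewrite -[RHS](id_lfunE t); congr (fun_of_lfun _ t).
apply: tensor_ext => phi psi; rewrite comp_lfunE id_lfunE.
rewrite (linfunE (@tdual_pre_linear U V)) /tdual_pre.
rewrite [in RHS](dual_expand phi) [in RHS](dual_expand psi) linear_sumlz.
apply: eq_bigr => i _; rewrite linear_sumr; apply: eq_bigr => j _.
by rewrite tdualE linearZl_LR linearZr_LR /= scalerA.
Qed.

Lemma tdualK U V : cancel (tdual U V) (tdual U V)^-1%VF.
Proof. by apply/lker0_lfunK/lker0P/(can_inj (@tdualK_pre U V)). Qed.

Lemma tdualVK U V : cancel (tdual U V)^-1%VF (tdual U V).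
Proof.
by move=> xi; apply: limg_lfunVK; rewrite -[xi]tdual_preK memv_img ?memvf.
Qed.

End Tensor.

Section ExtendedSemigroups.
Variables (K : fieldType) (A : vectType K).
Local Notation T2 := (tensor A A).
Local Notation T3 := (tensor (tensor A A) A).
Implicit Type Phi : 'End(T2).

(* Phi (x) Id and Id (x) Phi, on A (x) A (x) A bracketed to the left. *)
Definition on12 Phi : 'End(T3) := tmap Phi \1.

Definition on23 Phi : 'End(T3) :=
  (tassoc_inv A A A \o tmap \1 Phi \o tassoc A A A)%VF.

Lemma on12E Phi (x y z : A) :
  on12 Phi (pure (pure x y) z) = pure (Phi (pure x y)) z.
Proof. by rewrite /on12 tmapE id_lfunE. Qed.

Lemma on23E Phi (x y z : A) :
  on23 Phi (pure (pure x y) z) = tassoc_inv A A A (pure x (Phi (pure y z))).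
Proof. by rewrite /on23 !comp_lfunE tassocE tmapE id_lfunE. Qed.

Local Notation tau := (tswap A A).

Definition lEAS Phi : Prop :=
  (on23 Phi \o on12 Phi \o on23 Phi = on12 Phi \o on23 tau \o on12 Phi)%VF.

Definition lCEDS Phi : Prop :=
  lEAS Phi /\
  (on23 Phi \o on23 tau \o on12 tau \o on12 Phi =
   on12 tau \o on12 Phi \o on23 Phi \o on23 tau)%VF.

Definition dual_lCEDS Phi : Prop :=
  lEAS Phi /\
  (on12 Phi \o on12 tau \o on23 tau \o on23 Phi =
   on23 tau \o on23 Phi \o on12 Phi \o on12 tau)%VF.

End ExtendedSemigroups.

(* Phi^*, read on V^* (x) V^* through the isomorphism tdual. *)
Definition dual_map (K : fieldType) (V : vectType K) (Phi : 'End(tensor V V)) :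
    'End(tensor (dual V) (dual V)) :=
  ((tdual V V)^-1 \o transpose Phi \o tdual V V)%VF.

Lemma dual_mapE (K : fieldType) (V : vectType K) (Phi : 'End(tensor V V)) t s :
  tdual V V (dual_map Phi t) s = tdual V V t (Phi s).
Proof. by rewrite /dual_map !comp_lfunE tdualVK transposeE. Qed.

(* Main.v *)
Require Import Defs.
From mathcomp Require Import all_boot all_order all_algebra.
Set Implicit Arguments.
Unset Strict Implicit.
Unset Printing Implicit Defensive.

Import GRing.Theory.
Local Open Scope ring_scope.

(** Each of the three identities equates two composites of the operators
    [on12] and [on23], taken at Phi or at the flip. Transposition reverses
    composites. The two sides of the extended associativity identity are
    palindromes, so that identity is mapped to itself, whereas reversing each
    side of the second lCEDS identity gives the corresponding side of the
    second dual lCEDS identity, and conversely.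

    To make this precise, V^* (x) V^* (x) V^* is paired with V (x) V (x) V by
    [tdual3]; [dual_map Phi] is by construction the adjoint of Phi for the
    analogous pairing in degree two. [adjoint_on12] and [adjoint_on23]
    carry this to degree three, [adjoint_tswap] says that the flip is its own
    adjoint, and [adjoint_comp3] and [adjoint_comp4] reverse composites. The
    pairing is perfect ([tdual3_bij]) because V is finite-dimensional, so two
    operators are equal if and only if their adjoints are ([adjoint_eq]). Hence
    each of the identities on V is equivalent to the reversed identity on V^*,
    and both implications come without passing through the bidual. *)

Section Adjoint.
Variables (K : fieldType) (X Y : vectType K) (b : 'Hom(X, dual Y)).

Definition adjoint (f : 'End(X)) (g : 'End(Y)) : Prop :=
  forall x y, b (f x) y = b x (g y).

Lemma adjoint_transpose (f : 'End(X)) (g : 'End(Y)) :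
  (b \o f = transpose g \o b)%VF -> adjoint f g.
Proof. by move=> bf x y; rewrite -comp_lfunE bf comp_lfunE transposeE. Qed.

Lemma adjoint_comp f f' g g' :
  adjoint f g -> adjoint f' g' -> adjoint (f \o f')%VF (g' \o g)%VF.
Proof. by move=> fg fg' x y; rewrite !comp_lfunE fg fg'. Qed.

Lemma adjoint_comp3 f1 f2 f3 g1 g2 g3 :
  adjoint f1 g1 -> adjoint f2 g2 -> adjoint f3 g3 ->
  adjoint (f1 \o f2 \o f3)%VF (g3 \o g2 \o g1)%VF.
Proof.
by move=> a1 a2 a3; rewrite -comp_lfunA; do 2![apply: adjoint_comp => //].
Qed.

Lemma adjoint_comp4 f1 f2 f3 f4 g1 g2 g3 g4 :
  adjoint f1 g1 -> adjoint f2 g2 -> adjoint f3 g3 -> adjoint f4 g4 ->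
  adjoint (f1 \o f2 \o f3 \o f4)%VF (g4 \o g3 \o g2 \o g1)%VF.
Proof.
move=> a1 a2 a3 a4; rewrite -comp_lfunA -comp_lfunA.
by apply: adjoint_comp => //; rewrite comp_lfunA; apply: adjoint_comp3.
Qed.

Lemma dual_separates (u v : Y) : (forall phi : dual Y, phi u = phi v) -> u = v.
Proof.
move=> uv; rewrite (coord_vbasis (memvf u)) (coord_vbasis (memvf v)).
apply: eq_bigr => i _; congr (_ *: _).
by have := uv (linfun (coord (vbasis {:Y}) i : Y -> K^o)); rewrite !lfunE.
Qed.

(** Injectivity of the pairing [b] makes the left operator determined by the
    right one. Its surjectivity gives the converse, because the elements of the
    full dual separate points. *)
Lemma adjoint_eq f f' g g' : bijective b ->
  adjoint f g -> adjoint f' g' -> f = f' <-> g = g'.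
Proof.
move=> [c bK cK] fg fg'; split=> [ff'|gg'].
  apply/lfunP => y; apply: dual_separates => phi.
  by rewrite -[phi]cK -fg -fg' ff'.
apply/lfunP => x; apply: (can_inj bK); apply/lfunP => y.
by rewrite fg fg' gg'.
Qed.

End Adjoint.

Section DualTriple.
Variables (K : fieldType) (V : vectType K).
Local Notation D := (dual V).
Local Notation T3 A := (tensor (tensor A A) A).

Definition tdual3 : 'Hom(T3 D, dual (T3 V)) :=
  (tdual (tensor V V) V \o tmap (tdual V V) \1)%VF.

Lemma tdual3E t (c : D) s z :
  tdual3 (pure t c) (pure s z) = tdual V V t s * c z.
Proof. by rewrite /tdual3 comp_lfunE tmapE tdualE id_lfunE. Qed.

(** The pairing does not depend on the bracketing. This is what computes
    adjoints of [on23], which acts through the bracketing to the right, although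
    [tdual3] is defined on the bracketing to the left. *)
Lemma tdual3_assoc_inv (a : D) t x s :
  tdual3 (tassoc_inv D D D (pure a t)) (tassoc_inv V V V (pure x s)) =
  a x * tdual V V t s.
Proof.
(* Both sides are linear in t and in s, so it suffices to let both be pure. *)
pose Q : 'Hom(tensor D D, dual (tensor V V)) := linfun (fun t =>
  (tdual3 (tassoc_inv D D D (pure a t)) \o
     (tassoc_inv V V V \o linfun (pure x)))%VF).
have purexL : linear (pure x : tensor V V -> tensor V (tensor V V)).
  by move=> k p q; rewrite pure_linearr.
have QE p q : Q p q =
    tdual3 (tassoc_inv D D D (pure a p)) (tassoc_inv V V V (pure x q)).
  rewrite linfunE => [|k p1 p2]; first by rewrite !comp_lfunE (linfunE purexL).
  apply/lfunP => r; rewrite add_lfunE scale_lfunE !comp_lfunE.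
  by rewrite pure_linearr !linearP add_lfunE scale_lfunE.
rewrite -QE; suff -> : Q = a x *: tdual V V by rewrite !scale_lfunE.
apply: tensor_ext => b c; apply: tensor_ext => y z.
by rewrite QE !scale_lfunE !tassoc_invE tdual3E !tdualE -mulrA.
Qed.

(** Perfectness in degree three follows from two uses of (U (x) W)^* being
    U^* (x) W^*, the second with U = V (x) V. *)
Lemma tdual3_bij : bijective tdual3.
Proof.
have tmapK (A B : vectType K) (f : 'Hom(A, B)) (g : 'Hom(B, A)) :
    cancel f g -> cancel (tmap f (\1 : 'End(D))) (tmap g \1).
  move=> fK t; rewrite -comp_lfunE -[RHS](id_lfunE t).
  congr (fun_of_lfun _ t); apply: tensor_ext => u v.
  by rewrite comp_lfunE !tmapE !id_lfunE fK.
exists (tmap (tdual V V)^-1 \1 \o (tdual (tensor V V) V)^-1)%VF => t.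
  by rewrite !comp_lfunE tdualK tmapK //; apply: tdualK.
by rewrite !comp_lfunE tmapK ?tdualVK //; apply: tdualVK.
Qed.

Lemma adjoint_ext (f : 'End(T3 D)) (g : 'End(T3 V)) :
  (forall (a b c : D) (x y z : V),
     tdual3 (f (pure (pure a b) c)) (pure (pure x y) z) =
     tdual3 (pure (pure a b) c) (g (pure (pure x y) z))) ->
  adjoint tdual3 f g.
Proof.
move=> fg; apply: adjoint_transpose.
apply: tensor3_ext => a b c; apply: tensor3_ext => x y z.
by rewrite (comp_lfunE tdual3) fg (comp_lfunE _ tdual3) transposeE.
Qed.

Lemma adjoint_on12 (F : 'End(tensor D D)) (G : 'End(tensor V V)) :
  adjoint (tdual V V) F G -> adjoint tdual3 (on12 F) (on12 G).
Proof.
by move=> FG; apply: adjoint_ext => a b c x y z; rewrite !on12E !tdual3E FG.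
Qed.

Lemma adjoint_on23 (F : 'End(tensor D D)) (G : 'End(tensor V V)) :
  adjoint (tdual V V) F G -> adjoint tdual3 (on23 F) (on23 G).
Proof.
move=> FG; apply: adjoint_ext => a b c x y z; rewrite !on23E -!tassoc_invE.
by rewrite !tdual3_assoc_inv FG.
Qed.

Lemma adjoint_tswap : adjoint (tdual V V) (tswap D D) (tswap V V).
Proof.
apply: adjoint_transpose.
apply: tensor_ext => a b; apply: tensor_ext => x y.
by rewrite !comp_lfunE transposeE !tswapE !tdualE mulrC.
Qed.

End DualTriple.

Theorem proposition4p4 (K : fieldType) (V : vectType K)
    (Phi : 'End(tensor V V)) :
  [/\ lEAS Phi <-> lEAS (dual_map Phi),
      lCEDS Phi <-> dual_lCEDS (dual_map Phi)
    & dual_lCEDS Phi <-> lCEDS (dual_map Phi)].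
Proof.
have aPhi : adjoint (tdual V V) (dual_map Phi) Phi by exact: dual_mapE.
have aP12 := adjoint_on12 aPhi.
have aP23 := adjoint_on23 aPhi.
have at12 := adjoint_on12 (@adjoint_tswap _ V).
have at23 := adjoint_on23 (@adjoint_tswap _ V).
have eqv f f' g g' := @adjoint_eq _ _ _ _ f f' g g' (tdual3_bij V).
(* The factors are listed in their order in the identity for [dual_map Phi]; the
   reversed order is that of the identity for Phi. *)
have eas := eqv _ _ _ _ (adjoint_comp3 aP23 aP12 aP23)
                        (adjoint_comp3 aP12 at23 aP12).
have ceds := eqv _ _ _ _ (adjoint_comp4 aP12 at12 at23 aP23)
                         (adjoint_comp4 at23 aP23 aP12 at12).
have dual_ceds := eqv _ _ _ _ (adjoint_comp4 aP23 at23 at12 aP12)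
                              (adjoint_comp4 at12 aP12 aP23 at23).
by rewrite /lCEDS /dual_lCEDS /lEAS; split; tauto.
Qed.
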